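(* Let $d\ge1$ and $1\le p<\infty$. There exist positive constants $C_1(d,p),C_2(d,p)$ depending only on $d,p$ such that for every generalised $d$-hypersurface $\mathbb S=(S,\sigma,v)$ with $\int_S\|v\|_2^p\,d\sigma<\infty$, $$C_1(d,p)\,Q_d^p(\mathbb S)\le\mathrm{vis}^p(\mathbb S)\le C_2(d,p)\,Q_d^p(\mathbb S).$$ Moreover, $$\mathrm{vis}^p(\mathbb S)\asymp_{d,p}\inf_{\substack{A\in GL(d)\\|\det A|=1}}a(A)\asymp_{d,p}Q_d^p(\mathbb S),\qquad a(A)=\Big(\int_S\|Av(x)\|_2^p\,d\sigma(x)\Big)^{1/p}.$$
   Context: A generalised $d$-hypersurface is a triple $\mathbb S=(S,\sigma,v)$ where $(S,\sigma)$ is a $\sigma$-finite measure space and $v:S\to\mathbb R^d$ is measurable. $$Q_d^p(\mathbb S)=\Big(\int_S\cdots\int_S|v(x_1)\wedge\cdots\wedge v(x_d)|^p\,d\sigma(x_1)\cdots d\sigma(x_d)\Big)^{1/(dp)},$$ where $|v_1\wedge\cdots\wedge v_d|$ is the volume of the parallelotope spanned by the vectors. $K^p(\mathbb S)=\{y\in\mathbb R^d:(\int_S|\langle y,v(x)\rangle|^p\,d\sigma(x))^{1/p}\le1\}$ and $\mathrm{vis}^p(\mathbb S)=|K^p(\mathbb S)|^{-1/d}$ (superscript $p$ is an index, not a power), equal to $0$ if $|K^p(\mathbb S)|=\infty$. $X\asymp_{d,p}Y$ means that $cX\le Y\le CX$ with positive constants $c,C$ depending only on $d,p$. *)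

(* Defs.v *)
From HB Require Import structures.
From mathcomp Require Import all_boot all_order all_algebra.
From mathcomp Require Import all_classical all_reals all_analysis.

Set Implicit Arguments.
Unset Strict Implicit.
Unset Printing Implicit Defensive.

Import Order.TTheory GRing.Theory Num.Theory.
Import numFieldNormedType.Exports.

Local Open Scope classical_set_scope.
Local Open Scope ring_scope.

(* The product measure [mu ^ n] on [n.-tuple T]: [mu ^ n.+1] is the image of
   [mu \x mu ^ n] under [(x, t) |-> x :: t]. *)
Section tuple_measure.
Local Open Scope ereal_scope.
Context {disp : measure_display} {T : measurableType disp} {R : realType}.

Definition tuple_cons n (z : T * n.-tuple T) : n.+1.-tuple T :=
  [tuple of z.1 :: z.2].

Lemma measurable_tuple_cons n :
  measurable_fun [set: T * n.-tuple T] (@tuple_cons n).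
Proof.
apply: (@measurable_cons _ _ _ _ fst n snd); first exact: measurable_fst.
exact: measurable_snd.
Qed.

Section step.
Variables (mu : {sigma_finite_measure set T -> \bar R}) (n : nat).
Variable (nu : {sigma_finite_measure set (n.-tuple T) -> \bar R}).

Definition cons_measure : set (n.+1.-tuple T) -> \bar R :=
  pushforward (mu \x nu) (@tuple_cons n).

Let preim_cons A : measurable A -> measurable (@tuple_cons n @^-1` A).
Proof.
by move=> mA; rewrite -[X in measurable X]setTI; exact: measurable_tuple_cons.
Qed.

Let cons_measure0 : cons_measure set0 = 0.
Proof. by rewrite /cons_measure /pushforward preimage_set0 measure0. Qed.

Let cons_measure_ge0 A : 0 <= cons_measure A.
Proof. by rewrite /cons_measure /pushforward; exact: measure_ge0. Qed.

Let cons_measure_sigma_additive : semi_sigma_additive cons_measure.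
Proof.
move=> F mF tF mUF; rewrite /cons_measure /pushforward preimage_bigcup.
apply: measure_semi_sigma_additive.
- by move=> k; exact: preim_cons.
- apply/trivIsetP => /= i j _ _ ij; rewrite -preimage_setI.
  by move/trivIsetP : tF => /(_ _ _ _ _ ij) ->//; rewrite preimage_set0.
- by rewrite -preimage_bigcup; exact: preim_cons.
Qed.

HB.instance Definition _ := isMeasure.Build _ _ _
  cons_measure cons_measure0 cons_measure_ge0 cons_measure_sigma_additive.

Definition tuple_uncons (t : n.+1.-tuple T) : T * n.-tuple T :=
  (thead t, [tuple of behead t]).

Lemma measurable_tuple_uncons :
  measurable_fun [set: n.+1.-tuple T] tuple_uncons.
Proof.
apply/measurable_fun_pairP; split; first exact: measurable_tnth.
exact: measurable_behead.
Qed.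

Let cons_measure_sigma_finite : sigma_finite setT cons_measure.
Proof.
have /sigma_finiteP[F [TF ndF Foo]] := sigma_finiteT mu.
have /sigma_finiteP[G [TG ndG Goo]] := sigma_finiteT nu.
exists (fun k => tuple_uncons @^-1` (F k `*` G k)).
  rewrite -preimage_bigcup; apply/esym/seteqP; split=> // t _.
  have [i _ Fi] : (\bigcup_i F i) (tuple_uncons t).1 by rewrite -TF.
  have [j _ Gj] : (\bigcup_i G i) (tuple_uncons t).2 by rewrite -TG.
  exists (maxn i j) => //; split.
    by move: Fi; exact/subsetPset/ndF/leq_maxl.
  by move: Gj; exact/subsetPset/ndG/leq_maxr.
move=> k; have [mF Fk] := Foo k; have [mG Gk] := Goo k; split.
  rewrite -[X in measurable X]setTI; apply: measurable_tuple_uncons => //.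
  exact: measurableX.
rewrite /cons_measure /pushforward -comp_preimage.
rewrite (_ : tuple_uncons \o _ = id).
  by rewrite product_measure1E// lte_mul_pinfty// ge0_fin_numE.
apply/funext => -[x t]; rewrite /= /tuple_uncons /tuple_cons theadE.
by congr (_, _); exact: val_inj.
Qed.

HB.instance Definition _ := @Measure_isSigmaFinite.Build _ (n.+1.-tuple T) R
  cons_measure cons_measure_sigma_finite.

End step.

Fixpoint tuple_measure (mu : {sigma_finite_measure set T -> \bar R}) (n : nat) :
    {sigma_finite_measure set (n.-tuple T) -> \bar R} :=
  match n with
  | 0 => @dirac _ (0.-tuple T) [tuple] R
  | m.+1 => cons_measure mu (tuple_measure mu m)
  end.

End tuple_measure.

Section euclidean.
Context {R : realType}.

(* R^d, with the Borel sigma-algebra (as the product sigma-algebra). *)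
Definition euclid (d : nat) : measurableType _ := d.-tuple (measurableTypeR R).

Definition lebesgue d : {sigma_finite_measure set (euclid d) -> \bar R} :=
  tuple_measure (@lebesgue_measure R) d.

Definition column d (y : euclid d) : 'cV[R]_d := \col_i tnth y i.

Definition dot d (y z : euclid d) : R := \sum_(i < d) tnth y i * tnth z i.

Definition norm2 d (u : 'cV[R]_d) : R := Num.sqrt (\sum_(i < d) u i ord0 ^+ 2).

Definition parallelotope d (w : 'I_d -> euclid d) : set (euclid d) :=
  [set y | exists t : 'I_d -> R, (forall j, 0 <= t j <= 1) /\
     forall i, tnth y i = \sum_(j < d) t j * tnth (w j) i].

(* |w_1 /\ ... /\ w_d| *)
Definition wedge_norm d (w : 'I_d -> euclid d) : \bar R :=
  lebesgue d (parallelotope w).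

End euclidean.
Arguments euclid : clear implicits.

(* \int ... \int f(x_1, ..., x_n) dsigma(x_1) ... dsigma(x_n) *)
Fixpoint iterated_integral (disp : measure_display) (T : measurableType disp)
    (R : realType) (sigma : {measure set T -> \bar R}) (n : nat) :
    (n.-tuple T -> \bar R) -> \bar R :=
  match n with
  | 0 => fun f => f [tuple]
  | m.+1 => fun f => (\int[sigma]_x
      iterated_integral sigma (fun t : m.-tuple T => f [tuple of x :: t]))%E
  end.

Record hypersurface (R : realType) (d : nat) := Hypersurface {
  hs_disp : measure_display;
  hs_space : measurableType hs_disp;
  hs_measure : {sigma_finite_measure set hs_space -> \bar R};
  hs_vec : hs_space -> euclid R d;
  measurable_hs_vec : measurable_fun [set: hs_space] hs_vec }.
Arguments hs_vec {R d} _ _.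

Section invariants.
Local Open Scope ereal_scope.
Context {R : realType} {d : nat}.
Variables (p : R) (S : hypersurface R d).
Local Notation sigma := (hs_measure S).
Local Notation v := (hs_vec S).

Definition finite_moment : Prop :=
  \int[sigma]_x ((norm2 (column (v x)) `^ p)%R)%:E < +oo.

Definition Qdp : \bar R :=
  (iterated_integral sigma (fun x : d.-tuple (hs_space S) =>
     wedge_norm (fun j => v (tnth x j)) `^ p)) `^ (d%:R * p)^-1.

Definition Kp : set (euclid R d) :=
  [set y | (\int[sigma]_x ((`|dot y (v x)| `^ p)%R)%:E) `^ p^-1 <= 1].

Definition visp : \bar R :=
  if lebesgue d Kp == +oo then 0 else (lebesgue d Kp `^ d%:R^-1)^-1.

Definition a_norm (A : 'M[R]_d) : \bar R :=
  (\int[sigma]_x ((norm2 (A *m column (v x)) `^ p)%R)%:E) `^ p^-1.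

Definition inf_a : \bar R :=
  ereal_inf [set a_norm A | A in [set A | A \in unitmx /\ `|\det A|%R = 1%R]].

End invariants.

(* X \asymp_{d,p} Y over the hypersurfaces satisfying [P]. *)
Definition asymp (R : realType) (d : nat) (P : hypersurface R d -> Prop)
    (X Y : hypersurface R d -> \bar R) : Prop :=
  exists c C : R, [/\ 0 < c, 0 < C & forall S, P S ->
    (c%:E * X S <= Y S)%E /\ (Y S <= C%:E * X S)%E].
Arguments asymp {R} d P X Y.

(* Main.v *)
(* The upper bounds on Q and vis are elementary: if |det A| = 1, then Q does
   not change when v is replaced by A v and Hadamard's inequality (with the
   constant d! coming from the Leibniz formula) bounds it by a(A); and K^p
   contains the image under A^T of a cube of side comparable to 1 / a(A).

   For the converse, take a basis b_1, ..., b_d of vectors of K^p whose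
   determinant is within a factor 2 of the supremum.  Rescaled to determinant 1
   it is the matrix of rows of a competitor A, so that
   inf a <= C |det b|^(-1/d); if the supremum is infinite, this gives
   inf a = 0.  By Cramer's rule near maximality confines the coordinates of
   the points of K^p in this basis to [-2, 2].  Hence |K^p| <= 4^d |det b|, which
   bounds vis from below.  It also means that in the basis b the seminorm
   N(y) = (\int |<y, v>|^p)^(1/p) dominates each coordinate up to a factor 3;
   integrating out the vectors v(x_d), ..., v(x_1) one after the other, with a
   cofactor expansion at each step, bounds Q from below. *)

Require Import Defs.
From mathcomp Require Import all_boot all_order all_algebra.
From mathcomp Require Import all_classical all_reals all_analysis.
From mathcomp Require Import perm measurable_realfun ring.

Set Implicit Arguments.
Unset Strict Implicit.
Unset Printing Implicit Defensive.

Import Order.TTheory GRing.Theory Num.Theory.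
Import numFieldNormedType.Exports HBNNSimple.

Local Open Scope classical_set_scope.
Local Open Scope ring_scope.

(** * Integrals of nonnegative, possibly non-measurable functions *)

Section integral_without_measurability.
Local Open Scope ereal_scope.
Context {disp : measure_display} {T : measurableType disp} {R : realType}.
Variable mu : {measure set T -> \bar R}.

Lemma ge0_le_integralT (f g : T -> \bar R) : (forall x, 0 <= f x) ->
  (forall x, f x <= g x) -> \int[mu]_x f x <= \int[mu]_x g x.
Proof.
move=> f0 fg; have g0 x : 0 <= g x by exact: le_trans (fg x).
rewrite !ge0_integralTE//; apply: le_ereal_sup => _ [h hf <-].
by exists h => // x; exact: le_trans (hf x) _.
Qed.

Lemma ge0_integralTZl (k : R) (f : T -> \bar R) : (0 < k)%R ->
  (forall x, 0 <= f x) -> \int[mu]_x (k%:E * f x) = k%:E * \int[mu]_x f x.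
Proof.
have le_scale (c : R) (g : T -> \bar R) : (0 < c)%R -> (forall x, 0 <= g x) ->
    c%:E * \int[mu]_x g x <= \int[mu]_x (c%:E * g x).
  move=> c0 g0; rewrite -lee_pdivlMl// ge0_integralTE//.
  apply: ge_ereal_sup => _ [h hg <-]; rewrite lee_pdivlMl//.
  rewrite -sintegralrM (_ : (_ \* _)%R = scale_nnsfun h (ltW c0))//.
  rewrite ge0_integralTE; last by move=> x; rewrite mule_ge0// lee_fin ltW.
  apply: ereal_sup_ubound; exists (scale_nnsfun h (ltW c0)) => // x /=.
  by rewrite EFinM lee_pmul2l.
move=> k0 f0; apply/eqP; rewrite eq_le le_scale// andbT.
have kf0 x : 0 <= k%:E * f x by rewrite mule_ge0// lee_fin ltW.
rewrite -lee_pdivrMl// (le_trans (le_scale _ _ _ kf0)) ?invr_gt0//.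
rewrite le_eqVlt; apply/orP; left; apply/eqP.
apply: eq_integral => x _; rewrite muleA -EFinM mulVf ?mul1e//.
exact: lt0r_neq0.
Qed.

End integral_without_measurability.

(** * Product measures and iterated integrals *)

Section tuple_measure_theory.
Local Open Scope ereal_scope.
Context {disp : measure_display} {T : measurableType disp} {R : realType}.
Variable mu : {sigma_finite_measure set T -> \bar R}.

Lemma tuple_measureS n (E : set (n.+1.-tuple T)) : tuple_measure mu n.+1 E =
  \int[mu]_x tuple_measure mu n [set t : n.-tuple T | E [tuple of x :: t]].
Proof.
apply: eq_integral => x _ /=; congr (tuple_measure mu n _).
by apply/seteqP; split=> t; rewrite /xsection /= inE.
Qed.

Lemma tuple_measureS2 n (E : set (n.+1.-tuple T)) : measurable E ->
  tuple_measure mu n.+1 E =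
  \int[tuple_measure mu n]_t mu [set x : T | E [tuple of x :: t]].
Proof.
move=> mE; rewrite [LHS](@product_measure_unique _ _ _ _ _ _ _
    (mu \x^ tuple_measure mu n))//=.
- apply: eq_integral => t _ /=; congr (mu _).
  by apply/seteqP; split=> x; rewrite /ysection /= inE.
- by move=> *; rewrite product_measure2E.
- by rewrite -[X in measurable X]setTI; exact: measurable_tuple_cons.
Qed.

Lemma le_tuple_measure n (E F : set (n.-tuple T)) : E `<=` F ->
  tuple_measure mu n E <= tuple_measure mu n F.
Proof.
elim: n E F => [|n IH] E F EF.
  rewrite /= !diracE lee_fin ler_nat.
  by case: (boolP (_ \in E)) => //; rewrite inE => /EF; rewrite -in_setE => ->.
rewrite !tuple_measureS; apply: ge0_le_integralT => x; first exact: measure_ge0.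
by apply: IH => t; exact: EF.
Qed.

End tuple_measure_theory.

Section iterated_integral_theory.
Local Open Scope ereal_scope.
Context {disp : measure_display} {T : measurableType disp} {R : realType}.
Variable mu : {measure set T -> \bar R}.

Lemma iterated_integral_ge0 n (f : n.-tuple T -> \bar R) :
  (forall t, 0 <= f t) -> 0 <= iterated_integral mu f.
Proof.
elim: n f => [|n IH] f f0 //=.
by apply: integral_ge0 => x _; exact: IH.
Qed.

Lemma le_iterated_integral n (f g : n.-tuple T -> \bar R) :
  (forall t, 0 <= f t) -> (forall t, f t <= g t) ->
  iterated_integral mu f <= iterated_integral mu g.
Proof.
elim: n f g => [|n IH] f g f0 fg //=.
by apply: ge0_le_integralT => x; [exact: iterated_integral_ge0|exact: IH].
Qed.

Lemma eq_iterated_integral n (f g : n.-tuple T -> \bar R) : f =1 g ->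
  iterated_integral mu f = iterated_integral mu g.
Proof. by move=> /funext ->. Qed.

Lemma iterated_integralZl n k (f : n.-tuple T -> \bar R) : (0 < k)%R ->
  (forall t, 0 <= f t) ->
  iterated_integral mu (fun t => k%:E * f t) = k%:E * iterated_integral mu f.
Proof.
move=> k0; elim: n f => [|n IH] f f0 //=.
rewrite -ge0_integralTZl//; last by move=> x; exact: iterated_integral_ge0.
by apply: eq_integral => x _; exact: IH.
Qed.

Lemma iterated_integral_rcons n (f : n.+1.-tuple T -> \bar R) :
  iterated_integral mu f =
  iterated_integral mu (fun t => \int[mu]_x f [tuple of rcons t x]).
Proof.
elim: n f => [|n IH] f.
  by apply: eq_integral => x _ /=; congr f; exact: val_inj.
rewrite [LHS]/= [RHS]/=; apply: eq_integral => x _.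
rewrite -[LHS]/(iterated_integral mu (fun t : n.+1.-tuple T => f [tuple of x :: t])) IH.
apply: eq_iterated_integral => t; apply: eq_integral => y _.
by congr f; exact: val_inj.
Qed.

Lemma iterated_integral_prod n (g : T -> R) (r : R) :
  (forall x, 0 <= g x)%R -> \int[mu]_x (g x)%:E = r%:E ->
  iterated_integral mu (fun t : n.-tuple T => (\prod_(i < n) g (tnth t i))%:E)
    = (r ^+ n)%:E.
Proof.
move=> g0 gr; elim: n => [|n IH] /=; first by rewrite big_ord0.
have r0 : (0 <= r)%R by rewrite -lee_fin -gr integral_ge0// => x _; rewrite lee_fin.
under eq_integral => x _.
  rewrite (_ : iterated_integral _ _ = (r ^+ n)%:E * (g x)%:E); last first.
    under eq_iterated_integral => t.
      rewrite big_ord_recl EFinM tnth0.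
      under eq_bigr do rewrite tnthS.
      over.
    have := g0 x; rewrite le_eqVlt => /predU1P[<-|gx0].
      under eq_iterated_integral do rewrite mul0e.
      rewrite mule0; elim: (n) => //= m ->.
      by rewrite integral0.
    rewrite iterated_integralZl//; first by rewrite IH muleC.
    by move=> t; rewrite lee_fin prodr_ge0.
  over.
have := r0; rewrite le_eqVlt => /predU1P[r00|rgt0].
  case: n IH => [|n] IH.
    by rewrite expr0; under eq_integral do rewrite mul1e; rewrite gr -r00.
  rewrite -r00 !exprS mul0r; under eq_integral do rewrite mul0e.
  by rewrite integral0 mul0r.
by rewrite ge0_integralTZl ?exprn_gt0// gr -EFinM exprSr.
Qed.

End iterated_integral_theory.

(** * Linear change of variables for the Lebesgue measure *)

Lemma lebesgue_measure_affine (R : realType) (a k : R)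
    (E : set (measurableTypeR R)) : a != 0 ->
  measurable E ->
  lebesgue_measure E =
  (`|a|%:E * lebesgue_measure [set x : measurableTypeR R | E (a * x + k)%R])%E.
Proof.
move=> a0 mE.
pose f : measurableTypeR R -> measurableTypeR R := fun x : R => (a * x + k)%R.
have mf : measurable_fun setT f.
  by apply: measurable_funD => //; apply: measurable_funM.
pose mu : {measure set (measurableTypeR R) -> \bar R} :=
  mscale (NngNum (normr_ge0 a)) (pushforward (@lebesgue_measure R) f).
rewrite -[RHS]/(mu mf E); apply: lebesgue_measure_unique => // _ [[x y]] _ <-.
rewrite -[RHS]/(`|a|%:E * lebesgue_measure (f @^-1` `]x, y]%classic))%E.
rewrite lebesgue_measure_itv /= lte_fin.
have [a_gt0|a_lt0|/eqP] := ltgtP 0 a; last by rewrite eq_sym (negbTE a0).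
  have -> : f @^-1` `]x, y]%classic = `](x - k) / a, (y - k) / a]%classic.
    apply/seteqP; split=> z /=; rewrite /f !in_itv /= ltr_pdivrMr// ler_pdivlMr//;
      by rewrite ltrBlDr lerBrDr mulrC.
  rewrite lebesgue_measure_itv /= lte_fin ltr_pM2r ?invr_gt0// ltrD2r.
  case: ifP => _; last by rewrite mule0.
  by rewrite gtr0_norm// -EFinD -EFinM; congr _%:E; field.
have -> : f @^-1` `]x, y]%classic = `[(y - k) / a, (x - k) / a[%classic.
  apply/seteqP; split=> z /=; rewrite /f !in_itv /= ltr_ndivlMr// ler_ndivrMr//;
    by rewrite ltrBlDr lerBrDr mulrC andbC.
rewrite lebesgue_measure_itv /= lte_fin ltr_nM2r ?invr_lt0// ltrD2r.
case: ifP => _; last by rewrite mule0.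
by rewrite ltr0_norm// -EFinD -EFinM; congr _%:E; field.
Qed.

Section linear_change_of_variables.
Context {R : realType}.

Definition affine d (A : 'M[R]_d) (c : 'cV[R]_d) (y : euclid R d) : euclid R d :=
  [tuple (A *m column y + c) i ord0 | i < d].

Lemma column_affine d (A : 'M[R]_d) c y :
  column (affine A c y) = A *m column y + c.
Proof. by apply/colP => i; rewrite mxE tnth_mktuple. Qed.

Lemma column_inj d : injective (@column R d).
Proof. by move=> x y /colP xy; apply: eq_from_tnth => i; have := xy i; rewrite !mxE. Qed.

Lemma measurable_affine d (A : 'M[R]_d) c : measurable_fun setT (affine A c).
Proof.
apply/measurable_fun_tnthP => i.
rewrite (_ : _ \o _ = fun y => \sum_(j < d) A i j * tnth y j + c i ord0).
  apply: measurable_funD => //; apply: measurable_sum => j.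
  by apply: measurable_funM => //; exact: measurable_tnth.
apply/funext => y /=; rewrite tnth_mktuple !mxE; congr (_ + _).
by apply: eq_bigr => j _; rewrite mxE.
Qed.

Lemma measurable_preimage_affine d (A : 'M[R]_d) c E :
  measurable E -> measurable (affine A c @^-1` E).
Proof.
by move=> mE; rewrite -[X in measurable X]setTI; exact: measurable_affine.
Qed.

Definition scales_lebesgue d (A : 'M[R]_d) (c : 'cV[R]_d) :=
  forall E, measurable E ->
  (lebesgue d E = `|\det A|%:E * lebesgue d (affine A c @^-1` E))%E.

Lemma scales_lebesgue_comp d (A B : 'M[R]_d) (a b : 'cV[R]_d) :
  scales_lebesgue A a -> scales_lebesgue B b ->
  scales_lebesgue (A *m B) (A *m b + a).
Proof.
move=> sA sB E mE; rewrite sA// sB; last exact: measurable_preimage_affine.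
rewrite det_mulmx normrM EFinM muleA; congr (_ * lebesgue d _)%E.
apply/seteqP; split=> y /=;
  rewrite (_ : affine A a _ = affine (A *m B) (A *m b + a) y)//;
by apply: column_inj; rewrite !column_affine mulmxDr mulmxA addrA.
Qed.

Lemma column_cons d (x : R) (t : euclid R d) :
  @column R (1 + d) [tuple of x :: t] = col_mx x%:M (column t).
Proof.
apply/colP => i; have [j ->|j ->] := split_ordP i.
  rewrite col_mxEu !mxE ord1 eqxx mulr1n.
  by rewrite (_ : lshift d 0 = ord0) ?tnth0//; exact: val_inj.
rewrite col_mxEd !mxE (_ : rshift 1 j = lift ord0 j) ?tnthS//.
exact: val_inj.
Qed.

Lemma affine_cons d (A : 'M[R]_(1 + d)) c x t :
  let u := A *m col_mx x%:M (column t) + c in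
  affine A c [tuple of x :: t] =
  [tuple of u ord0 ord0 :: [tuple dsubmx u i ord0 | i < d]].
Proof.
move=> u; apply: column_inj; rewrite column_affine column_cons -/u.
rewrite column_cons -[LHS]vsubmxK; congr col_mx.
  apply/colP => i; rewrite [LHS]mxE [RHS]mxE ord1 eqxx mulr1n.
  by congr (u _ _); exact: val_inj.
by apply/colP => i; rewrite [RHS]mxE tnth_mktuple.
Qed.

Lemma measurable_section_cons d (E : set (euclid R d.+1)) (x : R) :
  measurable E -> measurable [set t : euclid R d | E [tuple of x :: t]].
Proof.
move=> mE; rewrite -[X in measurable X]setTI.
exact: (@measurable_cons _ _ _ _ (fun=> x) d id).
Qed.

Lemma measurable_section_head d (E : set (euclid R d.+1)) (t : euclid R d) :
  measurable E -> measurable [set x : measurableTypeR R | E [tuple of x :: t]].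
Proof.
move=> mE; rewrite -[X in measurable X]setTI.
exact: (@measurable_cons _ _ _ (measurableTypeR R) id d (fun=> t)).
Qed.

Lemma affine_cons_block d (a : R) (b : 'rV[R]_d) (b' : 'cV[R]_d) A (c : R) c' x
  (t : euclid R d) :
  affine (block_mx a%:M b b' A : 'M[R]_(1 + d)) (col_mx c%:M c') [tuple of x :: t] =
  [tuple of a * x + (b *m column t) ord0 ord0 + c :: affine A (x *: b' + c') t].
Proof.
rewrite affine_cons mul_block_col add_col_mx; apply: column_inj.
rewrite !column_cons column_affine; congr col_mx.
  apply/colP => i; rewrite [LHS]mxE [RHS]mxE (ord1 i) eqxx !mulr1n.
  rewrite (_ : ord0 = lshift d (ord0 : 'I_1)); last exact: val_inj.
  by rewrite col_mxEu -scalar_mxM !mxE eqxx !mulr1n.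
apply/colP => i; rewrite [LHS]mxE tnth_mktuple col_mxKd mul_mx_scalar.
by rewrite addrA [x *: b' + _]addrC.
Qed.

Lemma scales_lebesgue_lower d (A : 'M[R]_d) (b c : 'cV[R]_d) : A \in unitmx ->
  (forall c, scales_lebesgue A c) ->
  scales_lebesgue (block_mx 1%:M 0 b A : 'M[R]_(1 + d)) (col_mx 0 c).
Proof.
move=> uA sA E mE; rewrite det_lblock det1 mul1r /lebesgue !tuple_measureS.
rewrite -ge0_integralTZl ?normr_gt0 -?unitfE -?unitmxE//.
apply: eq_integral => x _.
rewrite -/(lebesgue _) (sA (x *: b + c)); last exact: measurable_section_cons.
congr (_ * lebesgue d _)%E; apply/funext => t.
rewrite -[LHS]/(E _) -[RHS]/(E _); congr (E _); apply/esym.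
have -> : (0 : 'cV[R]_1) = 0%:M by rewrite raddf0.
by rewrite affine_cons_block mul0mx mxE mul1r !addr0.
Qed.

Lemma scales_lebesgue_upper d (a c : R) (b : 'rV[R]_d) : a != 0 ->
  scales_lebesgue (block_mx a%:M b 0 1%:M : 'M[R]_(1 + d)) (col_mx c%:M 0).
Proof.
move=> a0 E mE; rewrite det_ublock det1 mulr1 det_scalar1 /lebesgue.
rewrite !tuple_measureS2//; last exact: measurable_preimage_affine.
rewrite -ge0_integralTZl ?normr_gt0//.
apply: eq_integral => t _.
apply: etrans (lebesgue_measure_affine ((b *m column t) ord0 ord0 + c) a0 _) _.
  exact: measurable_section_head.
congr (_ * lebesgue_measure _)%E; apply/funext => x.
rewrite -[LHS]/(E _) -[RHS]/(E _); congr (E _); apply/esym.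
rewrite affine_cons_block scaler0 addr0 addrA (_ : affine _ _ _ = t)//.
by apply: column_inj; rewrite column_affine mul1mx addr0.
Qed.

Lemma block_mx_pivot_unit d (A : 'M[R]_(1 + d)) : A \in unitmx ->
  drsubmx A \notin unitmx -> drsubmx A + dlsubmx A *m ursubmx A \in unitmx.
Proof.
move=> uA; rewrite -row_free_unit -kermx_eq0 => /rowV0Pn[w].
rewrite sub_kermx => /eqP wM w0.
rewrite -row_free_unit -kermx_eq0; apply/rowV0P => u; rewrite sub_kermx => /eqP uM.
pose al := u *m dlsubmx A; pose be := w *m dlsubmx A.
have hw : row_mx 0 w *m A = row_mx be 0.
  by rewrite -[A in LHS]submxK mul_row_block !mul0mx !add0r wM.
have hu : row_mx al u *m A = row_mx (al *m ulsubmx A + al) 0.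
  rewrite -[A in LHS]submxK mul_row_block; congr row_mx.
  by rewrite /al -mulmxA addrC -mulmxDr.
have be0 : be ord0 ord0 != 0.
  apply: contra w0 => /eqP be0.
  have be00 : be = 0 by apply/matrixP => i j; rewrite !ord1 be0 mxE.
  have := mulmxK uA (row_mx 0 w); rewrite hw be00 row_mx0 mul0mx.
  by rewrite -{1}[0]hsubmxK => /eq_row_mx[_ <-]; apply/eqP/rowP => i; rewrite !mxE.
pose r := (al *m ulsubmx A + al) ord0 ord0 / be ord0 ord0.
have : row_mx al u = r *: row_mx 0 w.
  apply: (can_inj (mulmxK uA)); rewrite hu -scalemxAl hw scale_row_mx scaler0.
  congr row_mx; apply/matrixP => i j; rewrite !ord1 [RHS]mxE /r divfK//.
rewrite scale_row_mx scaler0 => /eq_row_mx[al0 uE].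
have : al = 0 by [].
rewrite {1}/al uE -scalemxAl -/be => /matrixP /(_ ord0 ord0).
rewrite [LHS]mxE [RHS]mxE => /eqP; rewrite mulf_eq0 (negbTE be0) orbF => /eqP r0.
by rewrite r0 scale0r.
Qed.

(* Schur complement: [A = [a b; 0 1] * [1 0; c M]] when the lower right block [M]
   is invertible; otherwise a shear applied first makes it invertible. *)
Lemma scales_lebesgue_unit d (A : 'M[R]_d) c : A \in unitmx ->
  scales_lebesgue A c.
Proof.
elim: d A c => [A c _ E mE|d IH].
  rewrite det_mx00 normr1 mul1e; congr (lebesgue 0 _); apply/funext => t.
  by rewrite /preimage /mkset; congr (E _); apply: eq_from_tnth => -[].
rewrite -[d.+1]/(1 + d)%N => A c uA.
have lower (B : 'M[R]_d) b : B \in unitmx ->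
    scales_lebesgue (block_mx 1%:M 0 b B : 'M[R]_(1 + d)) 0.
  move=> uB; rewrite -(col_mx0 _ 1 d 1).
  by apply: scales_lebesgue_lower => // c'; exact: IH.
have upper a (b : 'rV[R]_d) : a != 0 ->
    scales_lebesgue (block_mx a%:M b 0 1%:M : 'M[R]_(1 + d)) 0.
  move=> a0; rewrite -(col_mx0 _ 1 d 1) -[in col_mx _ _](raddf0 (@scalar_mx R 1)).
  exact: scales_lebesgue_upper.
have mul (B C : 'M[R]_(1 + d)) : scales_lebesgue B 0 -> scales_lebesgue C 0 ->
    scales_lebesgue (B *m C) 0.
  by move=> sB sC; have := scales_lebesgue_comp sB sC; rewrite mulmx0 addr0.
have schur (B : 'M[R]_(1 + d)) : B \in unitmx -> drsubmx B \in unitmx ->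
    scales_lebesgue B 0.
  move=> uB uM; pose b := ursubmx B *m invmx (drsubmx B).
  pose a := (ulsubmx B - b *m dlsubmx B) ord0 ord0.
  have aE : a%:M = ulsubmx B - b *m dlsubmx B by rewrite -mx11_scalar.
  have BE : B = (block_mx a%:M b 0 1%:M : 'M[R]_(1 + d)) *m
                block_mx 1%:M 0 (dlsubmx B) (drsubmx B).
    rewrite mulmx_block !mul0mx !mul1mx !mulmx1 !mulmx0 !add0r aE subrK.
    by rewrite /b mulmxKV// submxK.
  have a0 : a != 0.
    apply: contraTneq uB => a0; rewrite unitmxE BE det_mulmx det_ublock a0.
    by rewrite det_scalar1 !mul0r unitr0.
  by rewrite BE; apply: mul; [exact: upper|exact: lower].
have transl b : scales_lebesgue (1%:M : 'M[R]_(1 + d)) b.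
  have sL := @scales_lebesgue_lower d 1%:M 0 (dsubmx b) (unitmx1 _ _)
    (fun c => IH _ c (unitmx1 _ _)).
  have := @scales_lebesgue_upper d 1 (usubmx b ord0 ord0) 0 (oner_neq0 _).
  move=> /scales_lebesgue_comp /(_ sL).
  rewrite -scalar_mx_block !mul1mx -mx11_scalar add_col_mx add0r addr0 vsubmxK.
  by [].
suff sA : scales_lebesgue A 0.
  by have := scales_lebesgue_comp (transl c) sA; rewrite mul1mx mulmx0 add0r.
have [|nM] := boolP (drsubmx A \in unitmx); first exact: schur.
pose U a := block_mx 1%:M a 0 1%:M : 'M[R]_(1 + d).
pose b := ursubmx A.
have UK : U b *m U (- b) = 1%:M.
  rewrite mulmx_block !mul0mx !mul1mx !mulmx1 !mulmx0 !add0r !addr0 addNr.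
  by rewrite -scalar_mx_block.
have -> : A = (A *m U b) *m U (- b) by rewrite -mulmxA UK mulmx1.
apply: mul; last by apply: upper; exact: oner_neq0.
apply: schur.
  by rewrite unitmx_mul uA /= unitmxE det_ublock !det1 mulr1 unitr1.
rewrite -[A]submxK mulmx_block block_mxKdr mulmx1 addrC.
exact: block_mx_pivot_unit.
Qed.

End linear_change_of_variables.

(** * Volume of parallelotopes *)

Section boxes.
Context {R : realType}.

Definition box d (lo hi : R) : set (euclid R d) :=
  [set y | forall i, lo <= tnth y i <= hi].

Lemma box_bigcap d lo hi : box lo hi =
  \bigcap_(i in [set: 'I_d])
    ((fun y : euclid R d => tnth y i) @^-1` `[lo, hi]%classic).
Proof.
apply/seteqP; split=> y /= yb i; first by move=> _; rewrite /= in_itv /=.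
by have := yb i I; rewrite /= in_itv.
Qed.

Lemma measurable_box d lo hi : measurable (@box d lo hi).
Proof.
rewrite box_bigcap; apply: fin_bigcap_measurable; first exact: finite_finset.
move=> i _; rewrite -[X in measurable X]setTI.
by apply: measurable_tnth => //; exact: measurable_itv.
Qed.

Lemma lebesgue_box d (lo hi : R) : lo <= hi ->
  lebesgue d (box lo hi) = ((hi - lo) ^+ d)%:E.
Proof.
move=> lohi; elim: d => [|d IH].
  by rewrite /= diracE (_ : _ \in _) //; apply/asboolP => -[].
rewrite /lebesgue tuple_measureS.
under eq_integral => x _.
  rewrite (_ : tuple_measure _ _ _ =
    ((hi - lo) ^+ d)%:E * (\1_(`[lo, hi]%classic : set R) x)%:E)%E; last first.
    rewrite indicE; case: (boolP (x \in _)) => [|] xI.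
      rewrite mule1 -IH; congr (lebesgue d _); apply/seteqP; split=> t /=.
        by move=> tb i; have := tb (lift ord0 i); rewrite tnthS.
      move=> tb i; have [j ->|->] := unliftP ord0 i; first by rewrite tnthS; exact: tb.
      by rewrite tnth0; move: xI; rewrite inE /= in_itv.
    rewrite mule0 (_ : [set t | _] = set0) ?measure0//.
    apply/seteqP; split=> t //= /(_ ord0); rewrite tnth0 => xb.
    by move: xI; rewrite notin_setE /= in_itv /= xb.
  over.
rewrite ge0_integralZl_EFin//; last 2 first.
- by apply/measurable_EFinP; exact: measurable_indic.
- by rewrite exprn_ge0// subr_ge0.
rewrite integral_indic// setIT.
rewrite [X in (_ * X)%E](_ : _ = lebesgue_measure `[lo, hi]%classic)//.
rewrite lebesgue_measure_itv /= lte_fin exprSr EFinM.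
move: lohi; rewrite le_eqVlt => /predU1P[->|->]; last by rewrite -EFinB.
by rewrite ltxx subrr.
Qed.

Lemma lebesgue_linear_box d (W : 'M[R]_d) (lo hi : R) : W \in unitmx ->
  lo <= hi -> lebesgue d (affine (invmx W) 0 @^-1` box lo hi) =
  (`|\det W| * (hi - lo) ^+ d)%:E.
Proof.
move=> uW lohi; have uV : invmx W \in unitmx by rewrite unitmx_inv.
have := scales_lebesgue_unit 0 uV (@measurable_box d lo hi).
rewrite lebesgue_box// => /(congr1 (fun z => `|\det W|%:E * z)%E).
rewrite -EFinM => ->; rewrite muleA -EFinM -normrM det_inv divff ?normr1 ?mul1e//.
by rewrite -unitfE -unitmxE.
Qed.

Lemma lebesgue_hyperplane d (u : 'rV[R]_d) : u != 0 ->
  lebesgue d [set y | (u *m column y) ord0 ord0 = 0] = 0%E.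
Proof.
case: d u => [|d] u u0; first by rewrite thinmx0 eqxx in u0.
pose H : set (euclid R d.+1) := [set z | tnth z ord0 = 0].
have mH : measurable H.
  rewrite -[X in measurable X]setTI.
  by apply: (measurable_tnth ord0 measurableT (measurable_set1 (0 : R))).
have H0 : lebesgue d.+1 H = 0%E.
  rewrite /lebesgue tuple_measureS2// integral0_eq// => t _.
  rewrite (_ : [set x | _] = [set 0]); first exact: lebesgue_measure_set1.
  by apply/seteqP; split=> x; rewrite /= /H /= tnth0.
pose B := row_ebase u; have uB : B \in unitmx by exact: row_ebase_unit.
have := scales_lebesgue_unit 0 uB mH; rewrite H0 => /esym/eqP.
rewrite mule_eq0 eqe normr_eq0 -[\det B == 0]negbK -unitfE -unitmxE uB /=.
move=> /eqP HB; apply/eqP; rewrite eq_le measure_ge0 andbT -HB.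
apply: le_tuple_measure => y /=; rewrite /H /= tnth_mktuple addr0 -/B.
rewrite -[in u *m _](mulmx_ebase u) rank_rV u0 -!mulmxA -/B.
rewrite [X in X *m _](mx11_scalar (col_ebase u)) mul_scalar_mx mxE.
move=> /eqP; rewrite mulf_eq0 => /orP[|].
  have := col_ebase_unit u; rewrite unitmxE {1}(mx11_scalar (col_ebase u)).
  by rewrite det_scalar1 unitfE => /negbTE ->.
rewrite mxE big_ord_recl big1 ?addr0 => [|i _].
  by rewrite mxE eqxx mul1r => /eqP.
by rewrite mxE mul0r.
Qed.

Lemma wedge_normE d (w : 'I_d -> euclid R d) :
  wedge_norm w = `|\det (\matrix_(i, j) tnth (w j) i)|%:E.
Proof.
set W := \matrix_(i, j) _.
have WE (t : 'I_d -> R) y : (forall i, tnth y i = \sum_(j < d) t j * tnth (w j) i)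
    <-> column y = W *m \col_j t j.
  split=> [yt|/colP yt i].
    by apply/colP => i; rewrite !mxE yt; apply: eq_bigr => j _; rewrite !mxE mulrC.
  have := yt i; rewrite !mxE => ->.
  by apply: eq_bigr => j _; rewrite !mxE mulrC.
have [uW|] := boolP (W \in unitmx).
  rewrite /wedge_norm (_ : parallelotope w = affine (invmx W) 0 @^-1` box 0 1).
    by rewrite lebesgue_linear_box// subr0 expr1n mulr1.
  apply/seteqP; split=> y /=.
    move=> [t [t01 /WE yt]] i.
    by rewrite tnth_mktuple addr0 yt mulKmx// mxE; exact: t01.
  move=> yb; exists (fun j => tnth (affine (invmx W) 0 y) j); split => //.
  apply/WE; rewrite -/(column _) column_affine addr0 mulKVmx//.
rewrite unitmxE unitfE negbK => /eqP dW; rewrite dW normr0.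
have : W \notin unitmx by rewrite unitmxE dW unitr0.
rewrite -row_free_unit -kermx_eq0 => /rowV0Pn[u].
rewrite sub_kermx => /eqP uW u0.
apply/eqP; rewrite eq_le measure_ge0 andbT.
rewrite -[X in (_ <= X)%E](lebesgue_hyperplane u0).
apply: le_tuple_measure => y [t [_ /WE yt]] /=.
by rewrite yt mulmxA uW mul0mx mxE.
Qed.

End boxes.

Section roots.
Context {R : realType}.

Lemma poweRVK (a q : R) : 0 <= a -> 0 < q -> ((a `^ q)%:E `^ q^-1 = a%:E)%E.
Proof.
by move=> a0 q0; rewrite poweR_EFin -powRrM mulfV ?powRr1// lt0r_neq0.
Qed.

Lemma poweRV_le (X : \bar R) (a q : R) : 0 <= a -> 0 < q -> (0 <= X)%E ->
  (X <= (a `^ q)%:E)%E -> (X `^ q^-1 <= a%:E)%E.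
Proof.
move=> a0 q0 X0 Xa; rewrite -[leRHS](poweRVK a0 q0).
by apply: gt0_ler_poweR; rewrite ?invr_ge0 ?(ltW q0)//;
  rewrite in_itv /= leey andbT// lee_fin powR_ge0.
Qed.

Lemma poweRV_ge (X : \bar R) (a q : R) : 0 <= a -> 0 < q -> (0 <= X)%E ->
  ((a `^ q)%:E <= X)%E -> (a%:E <= X `^ q^-1)%E.
Proof.
move=> a0 q0 X0 Xa; rewrite -[leLHS](poweRVK a0 q0).
by apply: gt0_ler_poweR; rewrite ?invr_ge0 ?(ltW q0)//;
  rewrite in_itv /= leey andbT// lee_fin powR_ge0.
Qed.

Lemma poweRV_le1 (X : \bar R) (q : R) : 0 < q -> (0 <= X)%E ->
  (X `^ q^-1 <= 1)%E <-> (X <= 1)%E.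
Proof.
move=> q0 X0; split=> [X1|X1]; last by apply: poweRV_le; rewrite ?powR1.
have : ((X `^ q^-1) `^ q <= 1 `^ q)%E.
  apply: gt0_ler_poweR => //; first exact: ltW.
    by rewrite in_itv /= leey andbT poweR_ge0.
  by rewrite in_itv /= leey andbT lee_fin.
by rewrite -poweRrM mulVf ?lt0r_neq0// poweRe1// poweR1r.
Qed.

Lemma powRV (x q : R) : 0 <= x -> x^-1 `^ q = (x `^ q)^-1.
Proof. by move=> x0; rewrite -powR_inv1// powRAC powR_inv1 ?powR_ge0. Qed.

Lemma powR_prod (I : finType) (f : I -> R) (p : R) : (forall i, 0 <= f i) ->
  (\prod_i f i) `^ p = \prod_i f i `^ p.
Proof.
move=> f0; suff [_ ->] : 0 <= \prod_i f i /\ (\prod_i f i) `^ p = \prod_i f i `^ p.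
  by [].
elim/big_ind2 : _ => [|x1 x2 y1 y2 [x0 <-] [y0 <-]|i _]; rewrite ?ler01 ?powR1//.
by rewrite mulr_ge0// powRM.
Qed.

End roots.

Section euclidean_norm.
Context {R : realType}.

Lemma norm2_ge0 d (u : 'cV[R]_d) : 0 <= norm2 u.
Proof. exact: sqrtr_ge0. Qed.

Lemma entry_le_norm2 d (u : 'cV[R]_d) i : `|u i ord0| <= norm2 u.
Proof.
rewrite -sqrtr_sqr ler_sqrt ?sumr_ge0// => [|j _]; last exact: sqr_ge0.
by rewrite (bigD1 i)//= lerDl sumr_ge0// => j _; exact: sqr_ge0.
Qed.

Lemma norm2_le d (u : 'cV[R]_d) (m : R) : 0 <= m ->
  (forall i, `|u i ord0| <= m) -> norm2 u <= d%:R * m.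
Proof.
move=> m0 um; rewrite -(ger0_norm (mulr_ge0 (ler0n _ d) m0)) -sqrtr_sqr.
rewrite ler_wsqrtr// (@le_trans _ _ (d%:R * m ^+ 2))//.
  rewrite mulr_natl -[in leRHS](card_ord d) -sumr_const ler_sum// => i _.
  by rewrite -real_normK ?num_real// ler_pXn2r// nnegrE.
rewrite exprMn ler_wpM2r ?sqr_ge0// -natrX ler_nat.
by case: (d) => // n; rewrite leq_pmulr.
Qed.

Lemma norm2_powR_le d (u : 'cV[R]_d) (p : R) : 0 < p ->
  norm2 u `^ p <= d%:R `^ p * \sum_i `|u i ord0| `^ p.
Proof.
move=> p0; set s := \sum_i _.
have s0 : 0 <= s by apply: sumr_ge0 => i _; exact: powR_ge0.
have um i : `|u i ord0| <= s `^ p^-1.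
  rewrite -[leLHS]powRr1// -(mulfV (lt0r_neq0 p0)) powRrM.
  rewrite ge0_ler_powR ?nnegrE ?invr_ge0 ?(ltW p0) ?powR_ge0//.
  by rewrite /s (bigD1 i)//= lerDl sumr_ge0// => j _; exact: powR_ge0.
have := norm2_le (powR_ge0 _ _) um.
move=> /(ge0_ler_powR (ltW p0)); rewrite !nnegrE norm2_ge0 mulr_ge0 ?powR_ge0//.
move=> /(_ isT isT); rewrite powRM ?powR_ge0// -powRrM mulVf ?powRr1//.
exact: lt0r_neq0.
Qed.

Lemma det_le_norm2 d (M : 'M[R]_d) : `|\det M| <= d`!%:R * \prod_j norm2 (col j M).
Proof.
rewrite -det_tr /determinant (le_trans (ler_norm_sum _ _ _))//.
rewrite mulr_natl -[in leRHS](card_Sn d) -sumr_const.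
apply: ler_sum => s _.
rewrite normrM normrX normrN1 expr1n mul1r normr_prod; apply: ler_prod => i _.
by rewrite normr_ge0/= (le_trans _ (entry_le_norm2 _ (s i)))// !mxE.
Qed.

End euclidean_norm.

(** * Iterated integrals of determinants *)

Section iterated_determinant.
Context {disp : measure_display} {T : measurableType disp} {R : realType}.
Variables (mu : {measure set T -> \bar R}) (p : R).

(* Integrating out the last column gives the seminorm of the vector of its
   cofactors, which dominates the first cofactor, again a determinant. *)
Lemma iterated_det_ge1 n (g : T -> 'cV[R]_n) :
  (forall (y : 'rV[R]_n) i, (`|y ord0 i| `^ p)%:E <=
    \int[mu]_x (`|(y *m g x) ord0 ord0| `^ p)%:E)%E ->
  (1 <= iterated_integral mu (fun t : n.-tuple T =>
    (`|\det (\matrix_(i, j) g (tnth t j) i ord0)| `^ p)%:E))%E.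
Proof.
elim: n g => [|n IH] g gP; first by rewrite /= det_mx00 normr1 powR1.
rewrite iterated_integral_rcons.
pose g' x := row' ord0 (g x).
have := IH g'; set F := iterated_integral _ _ => F1.
apply: (@le_trans _ _ F).
  apply: F1 => y i.
  pose y' : 'rV[R]_n.+1 := \row_j oapp (y ord0) 0 (unlift ord0 j).
  have := gP y' (lift ord0 i); rewrite mxE liftK /= => /le_trans; apply.
  apply: ge0_le_integralT => x; first by rewrite lee_fin powR_ge0.
  rewrite (_ : y' *m g x = y *m g' x)//; apply/matrixP => a b.
  rewrite !mxE big_ord_recl mxE unlift_none mul0r add0r.
  by apply: eq_bigr => k _; rewrite !mxE liftK (ord1 a) (ord1 b).
apply: le_iterated_integral => t; first by rewrite lee_fin powR_ge0.
pose M x := \matrix_(i, j) g (tnth [tuple of rcons t x] j) i ord0.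
have tM j x : tnth [tuple of rcons t x] (lift ord_max j) = tnth t j.
  by rewrite !(tnth_nth x) lift_max /= nth_rcons size_tuple ltn_ord.
have tm x : tnth [tuple of rcons t x] ord_max = x.
  by rewrite (tnth_nth x) /= nth_rcons size_tuple ltnn eqxx.
pose y : 'rV[R]_n.+1 := \row_i ((-1) ^+ (i + n) *
  \det (\matrix_(k, j) g (tnth t j) (lift i k) ord0)).
have detM x : \det (M x) = (y *m g x) ord0 ord0.
  rewrite (expand_det_col _ ord_max) mxE; apply: eq_bigr => i _.
  rewrite mxE tm mulrC /cofactor mxE; congr (_ * _ * _).
  by congr (\det _); apply/matrixP => k j; rewrite !mxE tM.
under eq_integral do rewrite -/(M _) detM.
apply: le_trans (gP y ord0); rewrite mxE normrM normrX normrN1 expr1n mul1r.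
rewrite lee_fin le_eqVlt; apply/orP; left; apply/eqP; congr (`|\det _| `^ p).
by apply/matrixP => k j; rewrite !mxE.
Qed.

End iterated_determinant.

(** * Comparison of the invariants of a hypersurface *)

Section hypersurface_seminorm.
Context {R : realType} {d : nat}.
Variables (p : R) (S : hypersurface R d).
Hypotheses (d_gt0 : (0 < d)%N) (p_ge1 : 1 <= p) (S_fin : finite_moment p S).
Local Notation sigma := (hs_measure S).
Local Notation w x := (column (hs_vec S x)).

Let p_gt0 : 0 < p. Proof. exact: lt_le_trans p_ge1. Qed.

(* The p-th power of the seminorm with unit ball [Kp]. *)
Definition moment (y : 'rV[R]_d) : \bar R :=
  (\int[sigma]_x (`|(y *m w x) ord0 ord0| `^ p)%:E)%E.

Lemma moment_ge0 y : (0 <= moment y)%E.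
Proof. by apply: integral_ge0 => x _; rewrite lee_fin powR_ge0. Qed.

Lemma momentZ (c : R) y : c != 0 -> moment (c *: y) = ((`|c| `^ p)%:E * moment y)%E.
Proof.
move=> c0; rewrite /moment -ge0_integralTZl ?powR_gt0 ?normr_gt0//.
apply: eq_integral => x _; rewrite -scalemxAl mxE normrM powRM// EFinM.
Qed.

Lemma moment_lty y : (moment y < +oo)%E.
Proof.
pose k := 1 + \sum_i `|y ord0 i|.
have k0 : 0 < k by rewrite ltr_wpDr// sumr_ge0.
apply: (@le_lt_trans _ _ (\int[sigma]_x ((k `^ p)%:E * (norm2 (w x) `^ p)%:E))%E).
  apply: ge0_le_integralT => x; first by rewrite lee_fin powR_ge0.
  rewrite -EFinM lee_fin -powRM ?norm2_ge0 ?(ltW k0)//.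
  rewrite ge0_ler_powR ?nnegrE ?(ltW p_gt0) ?mulr_ge0 ?norm2_ge0 ?(ltW k0)//.
  rewrite mxE (le_trans (ler_norm_sum _ _ _))// mulrDl mul1r mulr_suml.
  rewrite ler_wpDl ?norm2_ge0// ler_sum// => i _.
  by rewrite normrM ler_wpM2l// entry_le_norm2.
rewrite ge0_integralTZl ?powR_gt0//; last by move=> x; rewrite lee_fin powR_ge0.
by rewrite lte_mul_pinfty// lee_fin powR_ge0.
Qed.

Lemma measurable_moment (y : 'rV[R]_d) :
  measurable_fun setT (fun x => (`|(y *m w x) ord0 ord0| `^ p)%:E).
Proof.
apply/measurable_EFinP.
apply: (@measurableT_comp _ _ _ _ _ _ (fun z : R => z `^ p)).
  exact: measurable_powR.
apply: measurableT_comp => //.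
under eq_fun do rewrite mxE.
apply: measurable_sum => i; apply: measurable_funM => //.
under eq_fun do rewrite mxE.
apply: (@measurableT_comp _ _ _ _ _ _ (fun t : euclid R d => tnth t i)).
  exact: measurable_tnth.
exact: measurable_hs_vec.
Qed.

Lemma KpE : Kp p S = [set y | (moment (column y)^T <= 1)%E].
Proof.
apply/funext => y; apply/propext.
rewrite /Kp /mkset.
have -> : (\int[sigma]_x ((`|dot y (hs_vec S x)| `^ p)%R)%:E = moment (column y)^T)%E.
  apply: eq_integral => x _; rewrite mxE; congr ((`|_| `^ p)%R)%:E.
  by apply: eq_bigr => i _; rewrite !mxE.
by apply: poweRV_le1; [exact: p_gt0|exact: moment_ge0].
Qed.

Definition moment_mx (A : 'M[R]_d) : \bar R :=
  (\int[sigma]_x (norm2 (A *m w x) `^ p)%:E)%E.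

Lemma moment_mx_ge0 A : (0 <= moment_mx A)%E.
Proof. by apply: integral_ge0 => x _; rewrite lee_fin powR_ge0. Qed.

Lemma moment_mx_le A :
  (moment_mx A <= (d%:R `^ p)%:E * \sum_(i < d) moment (row i A))%E.
Proof.
rewrite -ge0_integral_sum//; last by move=> i; exact: measurable_moment.
rewrite -ge0_integralTZl ?powR_gt0 ?ltr0n//; last first.
  by move=> x; rewrite sume_ge0// => i _; rewrite lee_fin powR_ge0.
apply: ge0_le_integralT => x; first by rewrite lee_fin powR_ge0.
rewrite sumEFin -EFinM lee_fin (le_trans (norm2_powR_le _ p_gt0))//.
rewrite ler_wpM2l ?powR_ge0// ler_sum// => i _.
by rewrite -row_mul [in leRHS]mxE.
Qed.

Lemma moment_mx_lty A : (moment_mx A < +oo)%E.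
Proof.
apply: le_lt_trans (moment_mx_le A) _; rewrite lte_mul_pinfty ?lee_fin ?powR_ge0//.
by apply: lte_sum_pinfty => i _; exact: moment_lty.
Qed.

Lemma inf_a_le_rows (B : 'M[R]_d) (b : R) : 0 < b -> b ^+ d = `|\det B| ->
  (forall i, moment (row i B) <= 1)%E ->
  (inf_a p S <= (d%:R ^+ 2 / b)%:E)%E.
Proof.
move=> b0 bB mB.
have b_neq0 := lt0r_neq0 b0.
apply: (@le_trans _ _ (a_norm p S (b^-1 *: B))).
  apply: ereal_inf_lbound; exists (b^-1 *: B) => //.
  have dB : `|\det (b^-1 *: B)| = 1.
    rewrite detZ normrM normrX normfV (gtr0_norm b0) -bB -exprMn mulVf//.
    by rewrite expr1n.
  split=> //; rewrite unitmxE unitfE -normr_gt0 dB//.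
apply: poweRV_le => //; first by rewrite divr_ge0// ?exprn_ge0// ltW.
  exact: moment_mx_ge0.
apply: le_trans (moment_mx_le _) _.
rewrite powRM ?sqr_ge0 ?invr_ge0 ?(ltW b0)// expr2 powRM// -mulrA EFinM.
rewrite lee_wpmul2l ?lee_fin ?powR_ge0//.
apply: (@le_trans _ _ (\sum_(i < d) (b^-1 `^ p)%:E)%E).
  apply: lee_sum => i _; rewrite (_ : row i _ = b^-1 *: row i B); last first.
    by apply/rowP => j; rewrite !mxE.
  rewrite momentZ ?invr_neq0// ger0_norm ?invr_ge0 ?(ltW b0)//.
  by rewrite -[leRHS]mule1 lee_wpmul2l// lee_fin powR_ge0.
rewrite sumEFin lee_fin sumr_const card_ord -[leLHS]mulr_natl ler_wpM2r ?powR_ge0//.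
by rewrite le1r_powR// ler1n.
Qed.

Definition wedge_moment : \bar R :=
  iterated_integral sigma (fun t : d.-tuple (hs_space S) =>
    (`|\det (\matrix_(i, j) w (tnth t j) i ord0)| `^ p)%:E).

Lemma wedge_moment_ge0 : (0 <= wedge_moment)%E.
Proof. by apply: iterated_integral_ge0 => t; rewrite lee_fin powR_ge0. Qed.

Lemma QdpE : Qdp p S = (wedge_moment `^ (d%:R * p)^-1)%E.
Proof.
rewrite /Qdp; congr (_ `^ _)%E; apply: eq_iterated_integral => t.
rewrite wedge_normE poweR_EFin; congr (`|\det _| `^ p)%:E.
by apply/matrixP => i j; rewrite !mxE.
Qed.

Lemma mulmx_frame (A : 'M[R]_d) (t : d.-tuple (hs_space S)) :
  A *m \matrix_(i, j) w (tnth t j) i ord0 =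
  \matrix_(i, j) (A *m w (tnth t j)) i ord0.
Proof.
by apply/matrixP => i j; rewrite !mxE; apply: eq_bigr => k _; rewrite !mxE.
Qed.

Lemma a_normE A : exists2 a : R, 0 <= a &
  a_norm p S A = a%:E /\ moment_mx A = (a `^ p)%:E.
Proof.
have fA : moment_mx A \is a fin_num.
  by rewrite ge0_fin_numE ?moment_mx_lty ?moment_mx_ge0.
exists (fine (moment_mx A) `^ p^-1); first exact: powR_ge0.
rewrite -powRrM mulVf ?lt0r_neq0// powRr1 ?fine_ge0 ?moment_mx_ge0// fineK//.
by split=> //; rewrite -poweR_EFin fineK.
Qed.

Lemma Qdp_le_a_norm A : `|\det A| = 1 ->
  (Qdp p S <= d`!%:R%:E * a_norm p S A)%E.
Proof.
move=> dA; have [a a0 [-> mA]] := a_normE A.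
rewrite QdpE -EFinM; apply: poweRV_le.
- by rewrite mulr_ge0.
- by rewrite mulr_gt0// ltr0n.
- exact: wedge_moment_ge0.
apply: (@le_trans _ _ (iterated_integral sigma (fun t : d.-tuple (hs_space S) =>
    ((d`!%:R `^ p)%:E * (\prod_(j < d) norm2 (A *m w (tnth t j)) `^ p)%:E)%E))).
  apply: le_iterated_integral => t; first by rewrite lee_fin powR_ge0.
  rewrite -EFinM lee_fin -powR_prod => [|j]; last exact: norm2_ge0.
  rewrite -powRM ?prodr_ge0// => [|j _]; last exact: norm2_ge0.
  rewrite ge0_ler_powR ?nnegrE ?(ltW p_gt0) ?mulr_ge0 ?prodr_ge0//.
    by move=> j _; exact: norm2_ge0.
  have -> : `|\det (\matrix_(i, j) w (tnth t j) i ord0)| =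
      `|\det (\matrix_(i, j) (A *m w (tnth t j)) i ord0)|.
    by rewrite -mulmx_frame det_mulmx normrM dA mul1r.
  rewrite (le_trans (det_le_norm2 _))// ler_wpM2l// le_eqVlt; apply/orP; left.
  apply/eqP; apply: eq_bigr => j _; congr norm2.
  by apply/colP => i; rewrite [LHS]mxE [LHS]mxE.
rewrite iterated_integralZl ?powR_gt0 ?ltr0n ?fact_gt0//; last first.
  by move=> t; rewrite lee_fin prodr_ge0// => j _; exact: powR_ge0.
rewrite (iterated_integral_prod d _ mA) => [|x]; last exact: powR_ge0.
rewrite -EFinM lee_fin powRM// [d%:R * p]mulrC (powRrM a) powR_mulrn ?powR_ge0//.
rewrite ler_wpM2r ?exprn_ge0 ?powR_ge0// powRrM powR_mulrn ?powR_ge0//.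
rewrite -[leLHS]expr1 ler_weXn2l// -[leLHS](powRr0 d`!%:R).
by rewrite ler_powR ?(ltW p_gt0)// ler1n fact_gt0.
Qed.

Lemma visp_le (r : R) : 0 < r -> ((r ^+ d)%:E <= lebesgue d (Kp p S))%E ->
  (visp p S <= (r^-1)%:E)%E.
Proof.
move=> r0 rK; rewrite /visp; case: ifPn => [_|Kfin].
  by rewrite lee_fin invr_ge0 ltW.
have d0 : 0 < d%:R :> R by rewrite ltr0n.
have : (r%:E <= lebesgue d (Kp p S) `^ d%:R^-1)%E.
  by apply: poweRV_ge; rewrite ?(ltW r0)// powR_mulrn// ltW.
case: inveP => [|||x x0]; rewrite ?lee_fin ?invr_ge0 ?(ltW r0)//.
  by rewrite leNgt r0.
by move=> rx; rewrite lef_pV2// posrE (lt_le_trans r0).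
Qed.

Lemma visp_ge (r : R) : 0 < r -> (lebesgue d (Kp p S) <= (r ^+ d)%:E)%E ->
  ((r^-1)%:E <= visp p S)%E.
Proof.
move=> r0 Kr; rewrite /visp; case: ifPn => [/eqP Ky|_].
  by move: Kr; rewrite Ky leye_eq.
have d0 : 0 < d%:R :> R by rewrite ltr0n.
have : (lebesgue d (Kp p S) `^ d%:R^-1 <= r%:E)%E.
  by apply: poweRV_le; rewrite ?(ltW r0)// powR_mulrn// ltW.
have := poweR_ge0 (lebesgue d (Kp p S)) d%:R^-1.
case: inveP => [|||x x0] //; rewrite ?leey//.
by rewrite !lee_fin => x_ge0 xr; rewrite lef_pV2// posrE lt0r x0.
Qed.

Lemma visp_le_a_norm A : `|\det A| = 1 -> (visp p S <= d%:R%:E * a_norm p S A)%E.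
Proof.
move=> dA; have [a a0 [-> mA]] := a_normE A.
have d0 : 0 < d%:R :> R by rewrite ltr0n.
have uA : A^T \in unitmx by rewrite unitmx_tr unitmxE unitfE -normr_gt0 dA.
apply/lee_addgt0Pr => e e0; rewrite -EFinM -EFinD.
pose r := (d%:R * a + e)^-1.
have ae0 : 0 < d%:R * a + e by rewrite ltr_wpDl// mulr_ge0.
have r0 : 0 < r by rewrite invr_gt0.
rewrite -[_ + e]invrK -/r; apply: visp_le => //.
apply: (@le_trans _ _ (lebesgue d (affine (invmx A^T) 0 @^-1` box (- r) r))).
  rewrite lebesgue_linear_box ?ge0_cp ?(ltW r0)//.
  rewrite det_tr dA mul1r lee_fin opprK ler_pXn2r// ?nnegrE ?addr_ge0 ?(ltW r0)//.
  by rewrite lerDl ltW.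
apply: le_tuple_measure => y yb; rewrite KpE /=.
pose z := (column (affine (invmx A^T) 0 y))^T.
have zr i : `|z ord0 i| <= r by have := yb i; rewrite ler_norml !mxE.
have -> : (column y)^T = z *m A.
  by rewrite /z column_affine addr0 trmx_mul trmx_inv trmxK mulmxKV// -unitmx_tr.
apply: (@le_trans _ _ (((d%:R * r) `^ p)%:E * moment_mx A)%E).
  rewrite -ge0_integralTZl ?powR_gt0 ?mulr_gt0//; last first.
    by move=> x; rewrite lee_fin powR_ge0.
  apply: ge0_le_integralT => x; first by rewrite lee_fin powR_ge0.
  rewrite -EFinM lee_fin -powRM ?norm2_ge0 ?mulr_ge0 ?(ltW r0)//.
  rewrite ge0_ler_powR ?nnegrE ?(ltW p_gt0) ?mulr_ge0 ?norm2_ge0 ?(ltW r0)//.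
  rewrite -mulmxA mxE (le_trans (ler_norm_sum _ _ _))//.
  apply: (@le_trans _ _ (\sum_(i < d) r * norm2 (A *m w x))).
    by apply: ler_sum => i _; rewrite normrM ler_pM// entry_le_norm2.
  by rewrite sumr_const card_ord -mulrA mulr_natl.
rewrite mA -EFinM lee_fin -powRM ?mulr_ge0 ?(ltW r0)//.
rewrite [leRHS](_ : _ = 1 `^ p); last by rewrite powR1.
rewrite ge0_ler_powR ?nnegrE ?(ltW p_gt0) ?mulr_ge0 ?(ltW r0)//.
by rewrite mulrAC /r ler_pdivrMr// mul1r lerDl ltW.
Qed.

Definition dual_frame (B : 'M[R]_d) := forall i, (moment (row i B) <= 1)%E.

Lemma ex_dual_frame : exists2 B : 'M[R]_d, dual_frame B & \det B != 0.
Proof.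
pose e i : 'rV[R]_d := row i 1%:M.
have fe i : moment (e i) \is a fin_num by rewrite ge0_fin_numE ?moment_lty ?moment_ge0.
pose m := 1 + \sum_i fine (moment (e i)).
have m0 : 0 < m by rewrite ltr_wpDr// sumr_ge0// => i _; rewrite fine_ge0 ?moment_ge0.
have c0 : 0 < m^-1 `^ p^-1 by rewrite powR_gt0 ?invr_gt0.
exists (m^-1 `^ p^-1)%:M; last by rewrite det_scalar expf_neq0 ?lt0r_neq0.
move=> i; rewrite -scalemx1 linearZ /= momentZ ?lt0r_neq0// gtr0_norm//.
rewrite -powRrM mulVf ?lt0r_neq0// powRr1 ?invr_ge0 ?(ltW m0)//.
rewrite -/(e i) -(fineK (fe i)) -EFinM lee_fin ler_pdivrMl// mulr1.
rewrite /m (bigD1 i)//= addrCA lerDl addr_ge0// sumr_ge0// => j _.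
by rewrite fine_ge0 ?moment_ge0.
Qed.

Lemma det_root (B : 'M[R]_d) : \det B != 0 ->
  exists2 b : R, 0 < b & b ^+ d = `|\det B|.
Proof.
move=> dB; exists (`|\det B| `^ d%:R^-1); first by rewrite powR_gt0 ?normr_gt0.
rewrite -powR_mulrn ?powR_ge0// -powRrM mulVf ?powRr1//.
by rewrite pnatr_eq0 -lt0n.
Qed.

Lemma inf_a_le0_of_unbounded :
  (forall M : R, exists2 B, dual_frame B & M <= `|\det B|) -> (inf_a p S <= 0)%E.
Proof.
move=> unb; apply/lee_addgt0Pr => e e0; rewrite add0e.
have d0 : 0 < d%:R :> R by rewrite ltr0n.
pose r := d%:R ^+ 2 / e; have r0 : 0 < r by rewrite divr_gt0 ?exprn_gt0.
have [B fB] := unb (r ^+ d); have rd0 : 0 < r ^+ d by exact: exprn_gt0.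
move=> rB; have dB : \det B != 0 by rewrite -normr_gt0 (lt_le_trans rd0).
have [b b0 bB] := det_root dB.
apply: le_trans (inf_a_le_rows b0 bB fB) _.
rewrite lee_fin ler_pdivrMr// mulrC -ler_pdivrMr// -/r.
by rewrite -(ler_pXn2r d_gt0) ?nnegrE ?(ltW r0) ?(ltW b0)// bB.
Qed.

Lemma near_maximal_dual_frame : (inf_a p S <= 0)%E \/
  exists B, [/\ dual_frame B, \det B != 0 &
    forall B', dual_frame B' -> `|\det B'| <= 2 * `|\det B|].
Proof.
have [|nex] := pselect (exists B, [/\ dual_frame B, \det B != 0 &
    forall B', dual_frame B' -> `|\det B'| <= 2 * `|\det B|]); first by right.
left; apply: inf_a_le0_of_unbounded => M.
have [B0 fB0 dB0] := ex_dual_frame.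
have grow n : exists2 B, dual_frame B & 2 ^+ n * `|\det B0| <= `|\det B|.
  elim: n => [|n [B fB nB]]; first by exists B0; rewrite ?mul1r.
  have dB : \det B != 0.
    by rewrite -normr_gt0 (lt_le_trans _ nB)// mulr_gt0 ?normr_gt0// exprn_gt0.
  apply: contrapT => nB'; apply: nex; exists B; split=> // B' fB'.
  rewrite leNgt; apply/negP => lt2; apply: nB'; exists B' => //.
  by rewrite exprS -mulrA (le_trans _ (ltW lt2))// ler_pM2l.
have [B fB nB] := grow (Num.bound (`|M| / `|\det B0|)).
exists B => //; apply: le_trans nB; rewrite -ler_pdivrMr ?normr_gt0//.
apply: (@le_trans _ _ (`|M| / `|\det B0|)).
  by rewrite ler_wpM2r ?invr_ge0// ler_norm.
apply: le_trans (ltW (archi_boundP _)) _; first by rewrite divr_ge0.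
by rewrite -natrX ler_nat ltnW// ltn_expl.
Qed.

Lemma det_replace_row (B : 'M[R]_d) (t : 'rV[R]_d) i :
  \det (\matrix_(k, l) (if k == i then (t *m B) ord0 l else B k l)) =
  t ord0 i * \det B.
Proof.
rewrite (expand_det_row _ i).
have -> : t ord0 i * \det B = (t *m B *m \adj B) ord0 i.
  by rewrite -mulmxA mul_mx_adj mul_mx_scalar mxE mulrC.
rewrite [RHS]mxE; apply: eq_bigr => l _; rewrite !mxE eqxx; congr (_ * (_ * \det _)).
apply/matrixP => k m; rewrite !mxE ifN//.
by rewrite eq_sym neq_lift.
Qed.

Section near_maximal.
Variable B : 'M[R]_d.
Hypotheses (fB : dual_frame B) (dB : \det B != 0)
  (maxB : forall B', dual_frame B' -> `|\det B'| <= 2 * `|\det B|).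

Lemma coordinate_le (t : 'rV[R]_d) i : (moment (t *m B) <= 1)%E ->
  `|t ord0 i| <= 2.
Proof.
move=> tB; pose B' := \matrix_(k, l) (if k == i then (t *m B) ord0 l else B k l).
have : `|\det B'| <= 2 * `|\det B|.
  apply: maxB => k; have [->|ki] := eqVneq k i.
    have -> : row i B' = t *m B by apply/rowP => l; rewrite !mxE eqxx.
    exact: tB.
  have -> : row k B' = row k B by apply/rowP => l; rewrite !mxE (negbTE ki).
  exact: fB.
by rewrite det_replace_row normrM ler_pM2r ?normr_gt0.
Qed.

Lemma coordinate_moment_le (t : 'rV[R]_d) i :
  ((`|t ord0 i| `^ p)%:E <= moment (3 *: (t *m B)))%E.
Proof.
have [->|ti] := eqVneq (t ord0 i) 0.
  by rewrite normr0 powR0 ?lt0r_neq0// moment_ge0.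
have nt : 0 < `|t ord0 i| by rewrite normr_gt0.
rewrite leNgt; apply/negP => lt_t.
have : `|((3 / `|t ord0 i|) *: t) ord0 i| <= 2.
  apply: coordinate_le; rewrite -scalemxAl mulrC -scalerA momentZ ?invr_neq0 ?lt0r_neq0//.
  rewrite normfV normr_id powRV// lee_pdivrMl ?powR_gt0// mule1.
  exact: ltW.
by rewrite mxE normrM normf_div normr_id divfK ?lt0r_neq0// ger0_norm// ler_nat.
Qed.

Lemma wedge_moment_ge : (1 <= (`|\det (3 *: B)| `^ p)%:E * wedge_moment)%E.
Proof.
have dB3 : 0 < `|\det (3 *: B)| by rewrite normr_gt0 detZ mulf_neq0 ?expf_neq0.
rewrite -iterated_integralZl ?powR_gt0//.
apply: le_trans (@iterated_det_ge1 _ _ _ sigma p d (fun x => (3 *: B) *m w x) _) _.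
  move=> y i; apply: le_trans (coordinate_moment_le y i) _.
  by apply: ge0_le_integralT => x; rewrite ?lee_fin ?powR_ge0// mulmxA scalemxAr.
apply: le_iterated_integral => t; first by rewrite lee_fin powR_ge0.
by rewrite -mulmx_frame det_mulmx normrM powRM.
Qed.

Lemma Qdp_ge (b : R) : 0 < b -> b ^+ d = `|\det B| ->
  (((3 * b)^-1)%:E <= Qdp p S)%E.
Proof.
move=> b0 bB; rewrite QdpE; have b30 : 0 < 3 * b by rewrite mulr_gt0.
apply: poweRV_ge.
- by rewrite invr_ge0 ltW.
- by rewrite mulr_gt0// ltr0n.
- exact: wedge_moment_ge0.
have := wedge_moment_ge; rewrite detZ normrM normrX ger0_norm// -bB -exprMn.
rewrite -lee_pdivrMl ?powR_gt0 ?exprn_gt0// mule1; apply: le_trans.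
rewrite powRrM powR_mulrn ?invr_ge0 ?(ltW b30)// exprVn powRV//.
by rewrite exprn_ge0// ltW.
Qed.

Lemma lebesgue_Kp_le (b : R) : 0 < b -> b ^+ d = `|\det B| ->
  (lebesgue d (Kp p S) <= ((4 * b) ^+ d)%:E)%E.
Proof.
move=> b0 bB; have uB : B^T \in unitmx by rewrite unitmx_tr unitmxE unitfE.
apply: (@le_trans _ _ (lebesgue d (affine (invmx B^T) 0 @^-1` box (- 2) 2))).
  apply: le_tuple_measure => y; rewrite KpE => yK i.
  rewrite -ler_norml.
  have := @coordinate_le (column (affine (invmx B^T) 0 y))^T i.
  rewrite !mxE; apply.
  by rewrite column_affine addr0 trmx_mul trmx_inv trmxK mulmxKV// -unitmx_tr.
rewrite lebesgue_linear_box ?ge0_cp// det_tr -bB lee_fin mulrC exprMn.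
by rewrite opprK -natrD.
Qed.

End near_maximal.

Lemma inf_a_le_visp_Qdp : (inf_a p S <= (4 * d%:R ^+ 2)%:E * visp p S)%E /\
  (inf_a p S <= (3 * d%:R ^+ 2)%:E * Qdp p S)%E.
Proof.
have d0 : 0 < d%:R :> R by rewrite ltr0n.
have dd : 0 < d%:R ^+ 2 :> R by rewrite exprn_gt0.
have [I0|[B [fB dB maxB]]] := near_maximal_dual_frame.
  split; apply: (le_trans I0); rewrite mule_ge0 ?lee_fin ?mulr_ge0 ?(ltW dd)//.
    by rewrite /visp; case: ifP => // _; rewrite inve_ge0 poweR_ge0.
  exact: poweR_ge0.
have [b b0 bB] := det_root dB.
split; apply: (le_trans (inf_a_le_rows b0 bB fB)).
  have -> : d%:R ^+ 2 / b = 4 * d%:R ^+ 2 * (4 * b)^-1 by field; rewrite lt0r_neq0.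
  rewrite [leLHS]EFinM lee_wpmul2l ?lee_fin ?mulr_ge0 ?(ltW dd)//.
  by apply: visp_ge; [rewrite mulr_gt0|exact: (lebesgue_Kp_le fB dB maxB b0 bB)].
have -> : d%:R ^+ 2 / b = 3 * d%:R ^+ 2 * (3 * b)^-1 by field; rewrite lt0r_neq0.
rewrite [leLHS]EFinM lee_wpmul2l ?lee_fin ?mulr_ge0 ?(ltW dd)//.
exact: (Qdp_ge fB dB maxB b0 bB).
Qed.

Lemma visp_Qdp_le_inf_a : (visp p S <= d%:R%:E * inf_a p S)%E /\
  (Qdp p S <= d`!%:R%:E * inf_a p S)%E.
Proof.
have d0 : 0 < d%:R :> R by rewrite ltr0n.
split; rewrite -lee_pdivrMl ?ltr0n ?fact_gt0//;
  apply: le_ereal_inf_tmp => _ [A [_ dA] <-]; rewrite lee_pdivrMl ?ltr0n ?fact_gt0//.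
  exact: visp_le_a_norm.
exact: Qdp_le_a_norm.
Qed.

End hypersurface_seminorm.

Theorem theorem5p19 (R : realType) (d : nat) (p : R)
    (d_ge1 : (1 <= d)%N) (p_ge1 : 1 <= p) :
  [/\ exists C1 C2 : R, [/\ 0 < C1, 0 < C2 &
        forall S : hypersurface R d, finite_moment p S ->
          (C1%:E * Qdp p S <= visp p S)%E /\ (visp p S <= C2%:E * Qdp p S)%E],
      asymp d (finite_moment p) (visp p) (inf_a p)
    & asymp d (finite_moment p) (inf_a p) (Qdp p)].
Proof.
have d0 : 0 < d%:R :> R by rewrite ltr0n.
have f0 : 0 < d`!%:R :> R by rewrite ltr0n fact_gt0.
have v0 : 0 < 4 * d%:R ^+ 2 :> R by rewrite mulr_gt0// exprn_gt0.
have q0 : 0 < 3 * d%:R ^+ 2 :> R by rewrite mulr_gt0// exprn_gt0.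
split.
- exists (4 * d%:R ^+ 2 * d`!%:R)^-1, (d%:R * (3 * d%:R ^+ 2)).
  split; [by rewrite invr_gt0 mulr_gt0|exact: mulr_gt0|move=> S S_fin].
  have [Iv Iq] := inf_a_le_visp_Qdp d_ge1 p_ge1 S_fin.
  have [vI qI] := visp_Qdp_le_inf_a d_ge1 p_ge1 S_fin.
  split.
    rewrite lee_pdivrMl ?mulr_gt0// (le_trans qI)//.
    by rewrite [_ * d`!%:R]mulrC EFinM -muleA lee_pmul2l.
  by rewrite (le_trans vI)// EFinM -muleA lee_pmul2l.
- exists (d%:R)^-1, (4 * d%:R ^+ 2); split=> [||S S_fin] //.
    by rewrite invr_gt0.
  have [Iv _] := inf_a_le_visp_Qdp d_ge1 p_ge1 S_fin.
  have [vI _] := visp_Qdp_le_inf_a d_ge1 p_ge1 S_fin.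
  by rewrite lee_pdivrMl.
exists (3 * d%:R ^+ 2)^-1, d`!%:R; split=> [||S S_fin] //.
  by rewrite invr_gt0.
have [_ Iq] := inf_a_le_visp_Qdp d_ge1 p_ge1 S_fin.
have [_ qI] := visp_Qdp_le_inf_a d_ge1 p_ge1 S_fin.
by rewrite lee_pdivrMl.
Qed.
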